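(* Let $M$ be a generic regular closed curve parameterized by $S^1\ni s\mapsto f(s)\in\mathbb{R}^2$, and let $C$ be a smooth branch of the Centre Symmetry Set of $M$ that connects two inflexion points $f(t_1)$ and $f(t_2)$ of $M$. Then the number of inflexion points of $M$ on the arc $f\big((t_1,t_2)\big)$ is even.
   Context: Generic: $f$ is regular with only transversal self-crossings, only non-degenerate inflexion points (curvature changes sign, $\det(f',f''')\ne0$), no undulation points, at least one point of each parallel pair is not an inflexion point, and further non-degeneracy conditions on parallel pairs hold. Distinct points of $M$ form a parallel pair if their tangent lines are parallel; $\mathrm{CSS}(M)$ is the envelope of lines through parallel pairs, locally parameterized near a parallel pair $a=f(s)$, $b=g(t(s))$ (local arc-length parameterizations with $f'(s)=-g'(t(s))$) by $\frac{\kappa_f(s)f(s)+\kappa_g(t(s))g(t(s))}{\kappa_f(s)+\kappa_g(t(s))}$; where the denominator vanishes the line is an asymptote. Maximal such smooth curves are smooth semi-branches; those sharing an asymptote are joined, giving smooth branches. A branch connects two inflexion points if at each of its two ends the generating parallel pairs converge (both points) to that inflexion point. $f((t_1,t_2))$ is the open arc from $f(t_1)$ to $f(t_2)$ following the orientation of $S^1$. *)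

(* Defs.v *)
From Stdlib Require Import Reals Lra List.
From Coquelicot Require Import Coquelicot.
Open Scope R_scope.

(** Points of S^1 = R/Z: s and t represent the same point. *)
Definition same_pt (s t : R) : Prop :=
  cos (2 * PI * s) = cos (2 * PI * t) /\ sin (2 * PI * s) = sin (2 * PI * t).

Definition smooth_closed_curve (x y : R -> R) : Prop :=
  (forall (n : nat) (s : R), ex_derive_n x n s /\ ex_derive_n y n s) /\
  (forall s, x (s + 1) = x s /\ y (s + 1) = y s).

Definition dder (x y : R -> R) (i : nat) (s : R) (j : nat) (t : R) : R :=
  Derive_n x i s * Derive_n y j t - Derive_n y i s * Derive_n x j t.

Definition regular (x y : R -> R) : Prop :=
  forall s, Derive_n x 1 s <> 0 \/ Derive_n y 1 s <> 0.

Definition inflexion (x y : R -> R) (s : R) : Prop := dder x y 1 s 2 s = 0.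

Definition nondeg_inflexion (x y : R -> R) (s : R) : Prop :=
  inflexion x y s /\ dder x y 1 s 3 s <> 0.

Definition undulation (x y : R -> R) (s : R) : Prop :=
  inflexion x y s /\ dder x y 1 s 3 s = 0.

Definition parallel_pair (x y : R -> R) (s t : R) : Prop :=
  ~ same_pt s t /\ dder x y 1 s 1 t = 0.

Definition generic_curve (x y : R -> R) : Prop :=
  regular x y /\
  (forall s t, ~ same_pt s t -> x s = x t -> y s = y t -> dder x y 1 s 1 t <> 0) /\
  (forall s, inflexion x y s -> nondeg_inflexion x y s) /\
  (forall s, ~ undulation x y s) /\
  (forall s t, parallel_pair x y s t -> ~ inflexion x y s \/ ~ inflexion x y t).

Definition same_pair (s t s' t' : R) : Prop :=
  (same_pt s s' /\ same_pt t t') \/ (same_pt s t' /\ same_pt t s').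

Definition circ_lim (g : R -> R) (F : (R -> Prop) -> Prop) (t : R) : Prop :=
  filterlim (fun u => cos (2 * PI * g u)) F (locally (cos (2 * PI * t))) /\
  filterlim (fun u => sin (2 * PI * g u)) F (locally (sin (2 * PI * t))).

(** A smooth branch of CSS(M), described through its generating parallel pairs
    {f(a u), f(b u)}, u in (0,1):
    - the family of generating parallel pairs is a continuous, injective
      (as unordered pairs) path of parallel pairs,
    - which is maximal: a whole connected component of the set of parallel
      pairs (every path of parallel pairs starting on it stays on it);
      semi-branches are joined across asymptotes, so the branch is not cut at
      pairs with kappa_f + kappa_g = 0. *)
Definition css_branch (x y : R -> R) (a b : R -> R) : Prop :=
  (forall u, 0 < u < 1 ->
     continuity_pt a u /\ continuity_pt b u /\ parallel_pair x y (a u) (b u)) /\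
  (forall u v, 0 < u < 1 -> 0 < v < 1 ->
     same_pair (a u) (b u) (a v) (b v) -> u = v) /\
  (forall c d : R -> R,
     (forall v, 0 <= v <= 1 ->
        continuity_pt c v /\ continuity_pt d v /\ parallel_pair x y (c v) (d v)) ->
     (exists u, 0 < u < 1 /\ same_pair (c 0) (d 0) (a u) (b u)) ->
     exists u, 0 < u < 1 /\ same_pair (c 1) (d 1) (a u) (b u)).

Definition connects (x y : R -> R) (a b : R -> R) (t1 t2 : R) : Prop :=
  inflexion x y t1 /\ inflexion x y t2 /\
  circ_lim a (at_right 0) t1 /\ circ_lim b (at_right 0) t1 /\
  circ_lim a (at_left 1) t2 /\ circ_lim b (at_left 1) t2.

(** open arc of S^1 = [0,1) from t1 to t2 following the orientation,
    for 0 <= t1, t2 < 1 *)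
Definition in_arc (t1 t2 s : R) : Prop :=
  0 <= s < 1 /\
  (if Rlt_dec t1 t2 then t1 < s < t2 else t1 < s \/ s < t2).

(* Main.v *)
Require Import Defs.
From Stdlib Require Import Reals List ZArith Lra Lia.
From Coquelicot Require Import Coquelicot.
Open Scope R_scope.

(** The non-inflexion condition on parallel pairs makes the set of parallel
    pairs a level set of F(s, t) = det(f'(s), f'(t)) without critical points, so
    an injective path in it runs along the tangent field (F_t, - F_s) with a
    constant orientation. Near an inflexion t_i the two points of the pair lie
    on opposite sides of t_i; comparing the motion away from t_1 with the motion
    towards t_2 forces det(f', f''') to have opposite signs at t_1 and t_2.
    Since det(f', f'') has only simple zeros, its sign alternates between
    consecutive inflexions, and opposite signs mean an even number of zeros in
    between. *)

(** A branch is given only as a continuous path of pairs, so it has no velocity whose sign against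
    the tangent field could be followed. Chords of the path stand in for the velocity: the sign of
    the inner product of a short chord with the tangent at a nearby pair is locally constant,
    because the gradient of F is almost constant there. Orientation thereby becomes a statement that
    spreads from small intervals to all of (0, 1) without any reparameterization. The opposition of
    the two ends comes from time reversal. Near a start at t the chords have the sign opposite to
    det(f', f''')(t); the end at t_2 is the start of the reversed path, and reversal changes the
    sign of every chord. *)

(** * Connectedness arguments on intervals *)

(** The supremum of the points reachable from [p] replaces a finite subdivision obtained by
    compactness. It serves twice: to add up zero counts, and to carry the sign of chords along the
    branch. *)
Lemma cousin (Q : R -> R -> Prop) (p q : R) :
  p <= q ->
  (forall u v w, u <= v <= w -> Q u v -> Q v w -> Q u w) ->
  (forall z, p <= z <= q -> exists e, 0 < e /\
     forall u v, z - e < u -> u <= z <= v -> v < z + e -> p <= u -> v <= q -> Q u v) ->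
  Q p q.
Proof.
  intros Hpq Htr Hloc.
  pose (E := fun z => p <= z <= q /\ Q p z).
  assert (Ep : E p).
  { destruct (Hloc p ltac:(lra)) as [e [He H]]. split; [lra|apply H; lra]. }
  destruct (completeness E) as [m [Hub Hlub]].
  { exists q. intros z [Hz _]. lra. }
  { now exists p. }
  assert (Hm : p <= m <= q).
  { split; [now apply Hub|]. apply Hlub. intros z [Hz _]. lra. }
  destruct (Hloc m Hm) as [e [He H]].
  assert (exists z, E z /\ m - e < z) as [z [[Hz Qz] Hzm]].
  { apply Classical_Prop.NNPP. intros N.
    assert (m <= m - e); [|lra].
    apply Hlub. intros z Ez. destruct (Rle_lt_dec z (m - e)); auto.
    exfalso; eauto. }
  assert (z <= m) by (apply Hub; split; auto).
  assert (Key : forall v, m <= v -> v < m + e -> v <= q -> E v).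
  { intros v H1 H2 H3. split; [lra|].
    apply Htr with z; [lra|auto|]. apply H; lra. }
  destruct (Rle_lt_dec q m) as [Hq|Hq].
  - replace q with m by lra. apply Key; lra.
  - assert (E (Rmin q (m + e / 2))) as Ev.
    { apply Key; unfold Rmin; destruct (Rle_dec q (m + e / 2)); lra. }
    apply Hub in Ev. revert Ev. unfold Rmin; destruct (Rle_dec q (m + e / 2)); lra.
Qed.

Lemma same_sign_of_nonvanishing (h : R -> R) (p q : R) :
  p <= q ->
  (forall z, p <= z <= q -> continuity_pt h z) ->
  (forall z, p <= z <= q -> h z <> 0) ->
  0 < h p * h q.
Proof.
  intros Hpq Hc Hn.
  destruct (Req_dec p q) as [->|Hne].
  { specialize (Hn q ltac:(lra)). nra. }
  assert (Hp := Hn p ltac:(lra)). assert (Hq := Hn q ltac:(lra)).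
  destruct (Rlt_le_dec 0 (h p * h q)) as [|Hle]; auto. exfalso.
  destruct (Rlt_le_dec (h p) 0).
  - destruct (Ranalysis5.IVT_interv h p q) as [z [Hz H0]]; auto; try lra; try nra.
    now apply (Hn z).
  - destruct (Ranalysis5.IVT_interv (fun z => - h z) p q) as [z [Hz H0]]; try lra; try nra.
    + intros z Hz. now apply continuity_pt_opp, Hc.
    + apply (Hn z); auto. lra.
Qed.


Lemma segment_in_interval p q m n z :
  p < m < q -> p < n < q -> 0 <= z <= 1 -> p < m + z * (n - m) < q.
Proof. intros Hm Hn Hz. destruct (Rle_lt_dec m n); split; nra. Qed.

Lemma continuity_pt_segment (g : R -> R) p q m n z :
  (forall z, p < z < q -> continuity_pt g z) ->
  p < m < q -> p < n < q -> 0 <= z <= 1 ->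
  continuity_pt (fun z => g (m + z * (n - m))) z.
Proof.
  intros Hg Hm Hn Hz.
  apply (continuity_pt_comp (fun z => m + z * (n - m)) g).
  - apply derivable_continuous_pt. reg.
  - now apply Hg, segment_in_interval.
Qed.

(** The set of [(w, u, v)] with [u < v] is convex, hence connected. *)
Lemma same_sign_on_chords (K : R -> R -> R -> R) (p q : R) :
  (forall w u v w' u' v' z, p < w < q -> p < u < q -> p < v < q ->
     p < w' < q -> p < u' < q -> p < v' < q -> 0 <= z <= 1 ->
     continuity_pt (fun z => K (w + z * (w' - w)) (u + z * (u' - u)) (v + z * (v' - v))) z) ->
  (forall w u v, p < w < q -> p < u < q -> p < v < q -> u < v -> K w u v <> 0) ->
  forall w u v w' u' v', p < w < q -> p < u < q -> p < v < q ->
     p < w' < q -> p < u' < q -> p < v' < q -> u < v -> u' < v' ->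
  0 < K w u v * K w' u' v'.
Proof.
  intros Hc Hn w u v w' u' v' Hw Hu Hv Hw' Hu' Hv' Huv Huv'.
  assert (H := same_sign_of_nonvanishing
    (fun z => K (w + z * (w' - w)) (u + z * (u' - u)) (v + z * (v' - v))) 0 1).
  cbv beta in H. rewrite !Rmult_0_l, !Rplus_0_r, !Rmult_1_l, !Rplus_minus in H.
  apply H; [lra| |].
  - intros z Hz. now apply Hc.
  - intros z Hz. apply Hn; try now apply segment_in_interval.
    destruct (Rle_lt_dec (v - u) (v' - u')); nra.
Qed.

(** This is strict monotonicity with the direction left open: the increment has no zero on the
    connected set of pairs u < v. The base point [w] of [same_sign_on_chords] is a dummy here. *)
Lemma injective_same_sign (g : R -> R) (p q : R) :
  (forall z, p < z < q -> continuity_pt g z) ->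
  (forall u v, p < u < q -> p < v < q -> g u = g v -> u = v) ->
  forall u v u' v', p < u < q -> p < v < q -> p < u' < q -> p < v' < q ->
  u < v -> u' < v' -> 0 < (g v - g u) * (g v' - g u').
Proof.
  intros Hc Hi u v u' v' Hu Hv Hu' Hv' Huv Huv'.
  apply (same_sign_on_chords (fun _ u v => g v - g u) p q) with (w := u) (w' := u); auto.
  - intros. apply continuity_pt_minus; now apply continuity_pt_segment with p q.
  - intros _ m n _ Hm Hn Hmn E. apply Rminus_diag_uniq, Hi in E; auto. lra.
Qed.

(** * Parity of the number of simple zeros *)

(** The sign of [D] just to the right of [p], when the zeros of [D] are simple. *)
Definition rsign (D D' : R -> R) (p : R) : R :=
  if Req_dec_T (D p) 0 then sign (D' p) else sign (D p).

Lemma rsign_of_nonzero D D' p : D p <> 0 -> rsign D D' p = sign (D p).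
Proof. unfold rsign; now destruct (Req_dec_T (D p) 0). Qed.

Lemma rsign_of_zero D D' p : D p = 0 -> rsign D D' p = sign (D' p).
Proof. unfold rsign; now destruct (Req_dec_T (D p) 0). Qed.

Lemma sign_eq_of_mult_pos r r' : 0 < r * r' -> sign r = sign r'.
Proof.
  intros H. destruct (Rtotal_order r 0) as [?|[?|?]]; [|nra|].
  - rewrite 2!sign_eq_m1; nra.
  - rewrite 2!sign_eq_1; nra.
Qed.

(** Each simple zero flips [rsign] once. Half-open intervals make the count additive: a zero at the
    left end is already absorbed in [rsign] there, a zero at the right end is counted. Hence the
    relation is transitive and [cousin] leaves only small intervals, containing at most one zero. *)
Lemma simple_zeros_count (D D' : R -> R) (p q : R) :
  (forall z, is_derive D z (D' z)) ->
  (forall z, D z = 0 -> D' z <> 0) ->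
  p <= q ->
  exists l, NoDup l /\ (forall s, In s l <-> p < s <= q /\ D s = 0) /\
    rsign D D' q = rsign D D' p * (-1) ^ length l.
Proof.
  intros HD Hs Hpq.
  apply (cousin (fun p q => exists l, NoDup l /\ (forall s, In s l <-> p < s <= q /\ D s = 0) /\
    rsign D D' q = rsign D D' p * (-1) ^ length l)); auto.
  - intros u v w Huv [l1 [N1 [I1 S1]]] [l2 [N2 [I2 S2]]].
    exists (l1 ++ l2). split; [|split].
    + apply NoDup_app; auto. intros s Hs1 Hs2. apply I1 in Hs1. apply I2 in Hs2. lra.
    + intros s. rewrite in_app_iff, I1, I2. split; [intros [H|H]; lra|].
      intros [H1 H2]. destruct (Rle_lt_dec s v); [left|right]; lra.
    + rewrite length_app, pow_add, S2, S1. ring.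
  - intros z Hz. destruct (Req_dec (D z) 0) as [Z|Z].
    + assert (HD' := HD z). apply is_derive_Reals in HD'.
      assert (Hp := Hs z Z).
      (* With tolerance |D' z| the difference quotient keeps the sign of D' z. *)
      destruct (HD' (Rabs (D' z)) (Rabs_pos_lt _ Hp)) as [[e He] H]. simpl in H.
      assert (K : forall h, h <> 0 -> Rabs h < e -> 0 < (D' z * h) * D (z + h)).
      { intros h Hh Hh'. specialize (H h Hh Hh'). rewrite Z, Rminus_0_r in H.
        set (r := D (z + h) / h) in *. replace (D (z + h)) with (r * h) by (unfold r; field; auto).
        replace (D' z * h * (r * h)) with ((D' z * r) * (h * h)) by ring.
        apply Rmult_lt_0_compat; [|nra].
        destruct (Rtotal_order (D' z) 0) as [?|[?|?]]; [|lra|].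
        - rewrite (Rabs_left (D' z)) in H; auto. apply Rabs_def2 in H. nra.
        - rewrite (Rabs_right (D' z)) in H; [|lra]. apply Rabs_def2 in H. nra. }
      assert (KR : forall v, z < v < z + e -> D v <> 0 /\ rsign D D' v = sign (D' z)).
      { intros v Hv. specialize (K (v - z) ltac:(lra)).
        rewrite Rabs_right in K; [|lra]. replace (z + (v - z)) with v in K by ring.
        assert (0 < D' z * D v) by (specialize (K ltac:(lra)); nra).
        split; [nra|]. rewrite rsign_of_nonzero; [|nra]. symmetry; now apply sign_eq_of_mult_pos. }
      assert (KL : forall u, z - e < u < z -> D u <> 0 /\ rsign D D' u = - sign (D' z)).
      { intros v Hv. specialize (K (v - z) ltac:(lra)).
        rewrite Rabs_left in K; [|lra]. replace (z + (v - z)) with v in K by ring.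
        assert (0 < - D' z * D v) by (specialize (K ltac:(lra)); nra).
        split; [nra|]. rewrite rsign_of_nonzero; [|nra].
        rewrite <- sign_opp. symmetry; now apply sign_eq_of_mult_pos. }
      assert (K0 : rsign D D' z = sign (D' z)) by now apply rsign_of_zero.
      exists e. split; auto. intros u v Hu Huv Hv _ _.
      assert (Ev : rsign D D' v = sign (D' z)).
      { destruct (Req_dec v z) as [->|]; auto. apply KR; lra. }
      destruct (Req_dec u z) as [->|].
      (* The zero z is the excluded left end: nothing is counted and the sign does not change. *)
      * exists nil. split; [constructor|]. split.
        -- intros s; split; [intros []|]. intros [H1 H2]. exfalso.
           now apply (KR s); [lra|].
        -- simpl. rewrite K0, Ev. ring.
      * exists (z :: nil). split; [repeat constructor; auto|]. split.
        -- intros s; simpl; split; [intros [<-|[]]; split; auto; lra|].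
           intros [H1 H2]. left. destruct (Rtotal_order s z) as [?|[?|?]]; auto; exfalso.
           ++ now apply (KL s); [lra|].
           ++ now apply (KR s); [lra|].
        -- simpl. rewrite Ev. destruct (KL u ltac:(lra)) as [_ ->]. ring.
    + assert (Hc : continuity_pt D z).
      { apply continuity_pt_filterlim. apply (ex_derive_continuous D). now exists (D' z). }
      destruct (Hc (Rabs (D z)) (Rabs_pos_lt _ Z)) as [e [He H]].
      assert (K : forall s, z - e < s < z + e -> 0 < D z * D s).
      { intros s Hse. destruct (Req_dec s z) as [->|Hne]; [nra|].
        specialize (H s). simpl in H. unfold R_dist, D_x, no_cond in H.
        assert (Rabs (s - z) < e) by (apply Rabs_def1; lra).
        specialize (H ltac:(repeat split; auto)).
        destruct (Rtotal_order (D z) 0) as [?|[?|?]]; [|lra|].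
        - rewrite (Rabs_left (D z)) in H; auto. apply Rabs_def2 in H. nra.
        - rewrite (Rabs_right (D z)) in H; [|lra]. apply Rabs_def2 in H. nra. }
      exists e. split; auto. intros u v Hu Huv Hv _ _.
      exists nil. split; [constructor|]. split.
      * intros s; split; [intros []|]. intros [H1 H2]. assert (0 < D z * D s) by (apply K; lra).
        rewrite H2 in H0. lra.
      * simpl. rewrite Rmult_1_r.
        assert (Ku := K u ltac:(lra)). assert (Kv := K v ltac:(lra)).
        rewrite 2!rsign_of_nonzero by nra.
        now rewrite <- (sign_eq_of_mult_pos _ _ Ku), <- (sign_eq_of_mult_pos _ _ Kv).
Qed.

(** At the zeros p and q, [rsign] is the sign of D', so it changes from p to q and the count on (p,
    q] is odd. That count includes q; removing it leaves an even number. *)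
Lemma even_zeros_between (D D' : R -> R) (p q : R) :
  (forall z, is_derive D z (D' z)) ->
  (forall z, D z = 0 -> D' z <> 0) ->
  p < q -> D p = 0 -> D q = 0 -> D' p * D' q < 0 ->
  exists l, NoDup l /\ (forall s, In s l <-> p < s < q /\ D s = 0) /\ Nat.Even (length l).
Proof.
  intros HD Hs Hpq Dp Dq Hneg.
  destruct (simple_zeros_count D D' p q HD Hs ltac:(lra)) as [l [N [I Sg]]].
  assert (Iq : In q l) by (apply I; split; auto; lra).
  apply in_split in Iq. destruct Iq as [l1 [l2 ->]].
  apply NoDup_remove in N. destruct N as [N Nq].
  exists (l1 ++ l2). split; auto. split.
  - intros s. assert (Is := I s). rewrite in_app_iff in Is |- *. simpl in Is.
    split.
    + intros Hin. assert (s <> q).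
      { intros ->. apply Nq, in_app_iff; auto. }
      assert (p < s <= q /\ D s = 0) by (apply Is; tauto). lra.
    + intros [H1 H2]. destruct Is as [_ Is]. destruct Is as [H|[H|H]]; auto; [lra|].
      exfalso; lra.
  - rewrite 2!rsign_of_zero in Sg; auto.
    replace (length (l1 ++ q :: l2)) with (S (length (l1 ++ l2))) in Sg
      by (rewrite 2!length_app; simpl; lia).
    destruct (Nat.Even_or_Odd (length (l1 ++ l2))) as [|[k Hk]]; auto. exfalso.
    rewrite Hk in Sg. replace (S (2 * k + 1)) with (2 * (k + 1))%nat in Sg by lia.
    rewrite pow_1_even, Rmult_1_r in Sg.
    destruct (Rtotal_order (D' p) 0) as [?|[?|?]]; [|nra|].
    + rewrite (sign_eq_m1 (D' p)), (sign_eq_1 (D' q)) in Sg; nra.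
    + rewrite (sign_eq_1 (D' p)), (sign_eq_m1 (D' q)) in Sg; nra.
Qed.

(** If t2 < t1, the arc passes the base point of the circle. It is unrolled to the interval from t1
    to t2 + 1, and the zeros found there are folded back into [0, 1). *)
Lemma even_zeros_in_arc (D D' : R -> R) (t1 t2 : R) :
  (forall z, is_derive D z (D' z)) ->
  (forall z, D z = 0 -> D' z <> 0) ->
  (forall z, D (z + 1) = D z) -> (forall z, D' (z + 1) = D' z) ->
  0 <= t1 < 1 -> 0 <= t2 < 1 -> t1 <> t2 ->
  D t1 = 0 -> D t2 = 0 -> D' t1 * D' t2 < 0 ->
  exists l, NoDup l /\ (forall s, In s l <-> in_arc t1 t2 s /\ D s = 0) /\ Nat.Even (length l).
Proof.
  intros HD Hs P P' H1 H2 Hne D1 D2 Hneg. unfold in_arc.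
  destruct (Rlt_dec t1 t2) as [Hlt|Hlt].
  - destruct (even_zeros_between D D' t1 t2) as [l [N [I E]]]; auto.
    exists l. split; auto. split; auto. intros s. rewrite I. split; intros; split; lra.
  - destruct (even_zeros_between D D' t1 (t2 + 1)) as [l [N [I E]]]; auto;
      rewrite ?P, ?P'; auto; try lra.
    set (f := fun s => if Rlt_dec s 1 then s else s - 1).
    assert (Pm : forall z, D (z - 1) = D z).
    { intros z. rewrite <- P. f_equal; ring. }
    exists (map f l). split; [|split].
    (* Folding is injective because the unrolled interval is shorter than 1. *)
    + apply NoDup_map_NoDup_ForallPairs; auto. intros s s' Hs1 Hs2.
      apply I in Hs1. apply I in Hs2. unfold f.
      destruct (Rlt_dec s 1), (Rlt_dec s' 1); lra.
    + intros s. rewrite in_map_iff. split.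
      * intros [s' [Ef Hin]]. apply I in Hin. revert Ef. unfold f.
        destruct (Rlt_dec s' 1); intros <-; rewrite ?Pm; split; lra.
      * intros [Ha Hd]. destruct (Rlt_dec t1 s).
        -- exists s. split; [unfold f; destruct (Rlt_dec s 1); lra|]. apply I; split; auto; lra.
        -- exists (s + 1). split; [unfold f; destruct (Rlt_dec (s + 1) 1); lra|].
           apply I; split; [lra|]. now rewrite P.
    + now rewrite length_map.
Qed.

(** * Points of the circle and their lifts to the line *)

Lemma periodic_IZR (f : R -> R) :
  (forall s, f (s + 1) = f s) -> forall m s, f (s + IZR m) = f s.
Proof.
  intros Hf.
  assert (N : forall n s, f (s + INR n) = f s).
  { induction n as [|n IH]; intros s; [simpl; now rewrite Rplus_0_r|].
    rewrite S_INR, <- Rplus_assoc, Hf. apply IH. }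
  intros m s. destruct (Z.le_gt_cases 0 m) as [H|H].
  - rewrite <- (Z2Nat.id m), <- INR_IZR_INZ; auto.
  - rewrite <- (N (Z.to_nat (- m)) (s + IZR m)). f_equal.
    rewrite INR_IZR_INZ, Z2Nat.id, opp_IZR by lia. ring.
Qed.

Lemma cos_turn m s : cos (2 * PI * (s + IZR m)) = cos (2 * PI * s).
Proof.
  apply (periodic_IZR (fun s => cos (2 * PI * s))). clear s; intros s.
  rewrite <- (cos_period (2 * PI * s) 1). f_equal. simpl. ring.
Qed.

Lemma sin_turn m s : sin (2 * PI * (s + IZR m)) = sin (2 * PI * s).
Proof.
  apply (periodic_IZR (fun s => sin (2 * PI * s))). clear s; intros s.
  rewrite <- (sin_period (2 * PI * s) 1). f_equal. simpl. ring.
Qed.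

Lemma same_pt_of_shift s t m n : s - IZR m = t - IZR n -> same_pt s t.
Proof.
  intros H. replace s with (t + IZR (m - n)) by (rewrite minus_IZR; lra).
  split; [apply cos_turn | apply sin_turn].
Qed.

Lemma at_right_0_elim (P : R -> Prop) :
  at_right 0 P -> exists e, 0 < e /\ forall u, 0 < u < e -> P u.
Proof.
  intros [e He]. exists e. split; [apply cond_pos|]. intros u Hu. apply He; [|lra].
  change (Rabs (u - 0) < e). rewrite Rabs_right; lra.
Qed.

(** This cosine is the inner product of the unit vectors at [g u] and [t], so it measures their
    distance on the circle whatever the lifts. An error of k/4 in each coordinate lowers it by at
    most k/2. *)
Lemma circ_lim_cos (g : R -> R) (t : R) :
  circ_lim g (at_right 0) t ->
  forall k, 0 < k -> exists e, 0 < e /\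
    forall u, 0 < u < e -> 1 - k < cos (2 * PI * (g u - t)).
Proof.
  intros [Hc Hs] k Hk. assert (Hk2 : 0 < k / 4) by lra.
  assert (P := filter_and (F := at_right 0) _ _ (Hc _ (locally_ball (cos (2 * PI * t)) (mkposreal _ Hk2)))
                              (Hs _ (locally_ball (sin (2 * PI * t)) (mkposreal _ Hk2)))).
  apply at_right_0_elim in P. destruct P as [e [He P]]. exists e. split; auto.
  intros u Hu. destruct (P u Hu) as [P1 P2].
  apply Rabs_def2 in P1. apply Rabs_def2 in P2. simpl in P1, P2.
  unfold minus, plus, opp in P1, P2; simpl in P1, P2.
  replace (2 * PI * (g u - t)) with (2 * PI * g u - 2 * PI * t) by ring.
  rewrite cos_minus. revert P1 P2.
  assert (B := sin2_cos2 (2 * PI * t)). unfold Rsqr in B.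
  generalize dependent (cos (2 * PI * g u)). generalize dependent (sin (2 * PI * g u)).
  assert (Bc := COS_bound (2 * PI * t)). assert (Bs := SIN_bound (2 * PI * t)).
  revert B Bc Bs. generalize (cos (2 * PI * t)) (sin (2 * PI * t)). intros c s B Bc Bs s' c' P1 P2.
  assert (K : forall m n, -1 <= m <= 1 -> - (k / 4) < n < k / 4 -> - (k / 4) <= m * n).
  { intros m n Hm Hn.
    assert (0 <= (1 + m) * (k / 4 + n)) by (apply Rmult_le_pos; lra).
    assert (0 <= (1 - m) * (k / 4 - n)) by (apply Rmult_le_pos; lra). lra. }
  assert (K1 := K c (c' - c) ltac:(lra) ltac:(lra)).
  assert (K2 := K s (s' - s) ltac:(lra) ltac:(lra)).
  replace (c' * c + s' * s) with (c * c + s * s + c * (c' - c) + s * (s' - s)) by ring.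
  lra.
Qed.

Lemma cos_lower_bound_arg (r e : R) :
  Rabs r < 1 / 2 -> 0 <= e -> cos (2 * PI * e) < cos (2 * PI * r) -> Rabs r < e.
Proof.
  intros Hr He Hc. destruct (Rlt_le_dec (Rabs r) e) as [|Hle]; auto. exfalso.
  assert (HPI := PI_RGT_0).
  assert (E : cos (2 * PI * r) = cos (2 * PI * Rabs r)).
  { unfold Rabs; destruct (Rcase_abs r); auto. rewrite <- cos_neg. f_equal; ring. }
  rewrite E in Hc. apply Rlt_not_le in Hc. apply Hc.
  apply cos_decr_1; nra.
Qed.

(** Convergence on the circle fixes the limit only modulo 1. Once the cosine of 2π(g u - t) is
    positive, g u - t cannot cross a point at distance 1/4 from an integer, so by continuity it
    stays near one integer m; there a cosine close to 1 forces a small argument. *)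
Lemma circ_lim_lift (g : R -> R) (t : R) :
  (forall u, 0 < u < 1 -> continuity_pt g u) ->
  circ_lim g (at_right 0) t ->
  exists m, forall e, 0 < e -> exists d, 0 < d <= 1 /\ forall u, 0 < u < d -> Rabs (g u - IZR m - t) < e.
Proof.
  intros Hg Hlim. assert (Hcos := circ_lim_cos g t Hlim). assert (HPI := PI_RGT_0).
  destruct (Hcos 1 Rlt_0_1) as [d0' [Hd0' H0']].
  assert (exists d0, 0 < d0 <= 1 /\ forall u, 0 < u < d0 -> 0 < cos (2 * PI * (g u - t)))
    as [d0 [Hd0 H0]].
  { exists (Rmin d0' 1). unfold Rmin; destruct (Rle_dec d0' 1); (split; [lra|]);
    intros u Hu; specialize (H0' u ltac:(lra)); lra. }
  clear d0' Hd0' H0'.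
  (* A nearest integer to g (d0 / 2) - t: the remainder [h (d0 / 2)] lies in [-1/2, 1/2). *)
  set (m := up (g (d0 / 2) - t - 1 / 2)). exists m.
  destruct (archimed (g (d0 / 2) - t - 1 / 2)) as [A1 A2]. fold m in A1, A2.
  set (h := fun u => g u - t - IZR m).
  assert (Hh : forall u, cos (2 * PI * h u) = cos (2 * PI * (g u - t))).
  { intros u. unfold h. rewrite <- (cos_turn m). f_equal; ring. }
  assert (Q : forall r, cos (2 * PI * r) <> 0 -> r <> 1 / 4 /\ r <> - (1 / 4)).
  { intros r Hr. split; intros ->; apply Hr.
    - replace (2 * PI * (1 / 4)) with (PI / 2) by field. apply cos_PI2.
    - replace (2 * PI * - (1 / 4)) with (- (PI / 2)) by field. rewrite cos_neg. apply cos_PI2. }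
  assert (Hn : forall u, 0 < u < d0 -> h u <> 1 / 4 /\ h u <> - (1 / 4)).
  { intros u Hu. apply Q. rewrite Hh. specialize (H0 u Hu). lra. }
  assert (Hch : forall u, 0 < u < d0 -> continuity_pt h u).
  { intros u Hu. unfold h.
    repeat (apply continuity_pt_minus; [|apply continuity_pt_const; now intros ? ?]).
    apply Hg; lra. }
  assert (B0 : Rabs (h (d0 / 2)) < 1 / 4).
  { assert (Rabs (h (d0 / 2)) <= 1 / 2) by (apply Rabs_le; unfold h; lra).
    assert (E := H0 (d0 / 2) ltac:(lra)). rewrite <- Hh in E.
    destruct (Req_dec (Rabs (h (d0 / 2))) (1 / 2)) as [E2|].
    - exfalso.
      assert (cos (2 * PI * h (d0 / 2)) = -1); [|lra].
      revert E2. generalize (h (d0 / 2)). intros r. unfold Rabs; destruct (Rcase_abs r); intros E2.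
      + rewrite <- cos_neg. replace (- (2 * PI * r)) with (2 * PI * - r) by ring.
        rewrite E2. replace (2 * PI * (1 / 2)) with PI by field. apply cos_PI.
      + rewrite E2. replace (2 * PI * (1 / 2)) with PI by field. apply cos_PI.
    - apply cos_lower_bound_arg; try lra.
      replace (2 * PI * (1 / 4)) with (PI / 2) by field. now rewrite cos_PI2. }
  assert (S : forall u v, 0 < u < d0 -> 0 < v < d0 -> u <= v ->
    0 < (1 / 4 - h u) * (1 / 4 - h v) /\ 0 < (h u + 1 / 4) * (h v + 1 / 4)).
  { intros u v Hu Hv Huv. split.
    - apply (same_sign_of_nonvanishing (fun z => 1 / 4 - h z)); auto.
      + intros z Hz. apply continuity_pt_minus; [apply continuity_pt_const; now intros ? ?|].
        apply Hch; lra.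
      + intros z Hz. destruct (Hn z ltac:(lra)); lra.
    - apply (same_sign_of_nonvanishing (fun z => h z + 1 / 4)); auto.
      + intros z Hz. apply continuity_pt_plus; [|apply continuity_pt_const; now intros ? ?].
        apply Hch; lra.
      + intros z Hz. destruct (Hn z ltac:(lra)); lra. }
  assert (B : forall u, 0 < u < d0 -> Rabs (h u) < 1 / 4).
  { intros u Hu. apply Rabs_def2 in B0. apply Rabs_def1;
    destruct (Rle_lt_dec u (d0 / 2)) as [C|C].
    - destruct (S u (d0 / 2)); try lra. nra.
    - destruct (S (d0 / 2) u); try lra. nra.
    - destruct (S u (d0 / 2)); try lra. nra.
    - destruct (S (d0 / 2) u); try lra. nra. }
  intros e He.
  assert (He' : 0 < Rmin e (1 / 4) <= 1 / 4 /\ Rmin e (1 / 4) <= e).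
  { unfold Rmin; destruct (Rle_dec e (1 / 4)); lra. }
  set (e' := Rmin e (1 / 4)) in *.
  assert (Hce : 0 < 1 - cos (2 * PI * e')).
  { rewrite <- cos_0. apply Rlt_0_minus. apply cos_decreasing_1; nra. }
  destruct (Hcos _ Hce) as [d1 [Hd1 H1]].
  exists (Rmin d0 d1).
  assert (0 < Rmin d0 d1 /\ Rmin d0 d1 <= d0 /\ Rmin d0 d1 <= d1).
  { unfold Rmin; destruct (Rle_dec d0 d1); lra. }
  split; [lra|]. intros u Hu.
  replace (g u - IZR m - t) with (h u) by (unfold h; ring).
  apply Rlt_le_trans with e'; [|lra].
  assert (Bu := B u ltac:(lra)).
  apply cos_lower_bound_arg; try lra. rewrite Hh. specialize (H1 u ltac:(lra)). lra.
Qed.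

(** * Determinants of derivatives and chords of the level set of parallel pairs *)

(** The inner product of the chord from [(a u, b u)] to [(a v, b v)] with the
    tangent [(F_t, - F_s)] of the level set at [(a w, b w)]. *)
Definition chord (x y a b : R -> R) (w u v : R) : R :=
  (a v - a u) * dder x y 1 (a w) 2 (b w) - (b v - b u) * dder x y 2 (a w) 1 (b w).

Lemma Derive_n_periodic (f : R -> R) n :
  (forall s, f (s + 1) = f s) -> forall s, Derive_n f n (s + 1) = Derive_n f n s.
Proof. intros Hf s. rewrite <- Derive_n_comp_trans. now apply Derive_n_ext. Qed.

Lemma dder_shift x y i j m n s t :
  smooth_closed_curve x y -> dder x y i (s - IZR m) j (t - IZR n) = dder x y i s j t.
Proof.
  intros [_ P].
  assert (K : forall f k m s, (forall s, f (s + 1) = f s) ->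
    Derive_n f k (s - IZR m) = Derive_n f k s).
  { intros f k m' s' Hf. unfold Rminus. rewrite <- opp_IZR.
    apply periodic_IZR. now apply Derive_n_periodic. }
  unfold dder. rewrite !K; auto; intros; apply P.
Qed.

Lemma is_derive_Derive_n x y n s :
  smooth_closed_curve x y ->
  is_derive (Derive_n x n) s (Derive_n x (S n) s) /\
  is_derive (Derive_n y n) s (Derive_n y (S n) s).
Proof. intros [H _]. split; apply Derive_correct; apply (H (S n) s). Qed.

Lemma dder_antisym x y i j s t : dder x y i s j t = - dder x y j t i s.
Proof. unfold dder. ring. Qed.

Lemma is_derive_dder_r x y i s j t :
  smooth_closed_curve x y ->
  is_derive (fun t => dder x y i s j t) t (dder x y i s (S j) t).
Proof.
  intros H. destruct (is_derive_Derive_n x y j t H).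
  unfold dder. apply (is_derive_minus (fun t => Derive_n x i s * Derive_n y j t)
    (fun t => Derive_n y i s * Derive_n x j t)); now apply is_derive_scal.
Qed.

Lemma is_derive_dder_l x y i s j t :
  smooth_closed_curve x y ->
  is_derive (fun s => dder x y i s j t) s (dder x y (S i) s j t).
Proof.
  intros H. rewrite dder_antisym.
  apply (is_derive_ext (fun s => - dder x y j t i s)).
  { intros r. symmetry. apply dder_antisym. }
  apply (is_derive_opp (fun s => dder x y j t i s)). now apply is_derive_dder_r.
Qed.

(** The other term of the product rule, det(f'', f''), vanishes. Non-degenerate inflexions are thus
    simple zeros of det(f', f''). *)
Lemma is_derive_inflexion_det x y s :
  smooth_closed_curve x y ->
  is_derive (fun s => dder x y 1 s 2 s) s (dder x y 1 s 3 s).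
Proof.
  intros H. destruct (is_derive_Derive_n x y 1 s H). destruct (is_derive_Derive_n x y 2 s H).
  replace (dder x y 1 s 3 s) with
    ((Derive_n x 2 s * Derive_n y 2 s + Derive_n x 1 s * Derive_n y 3 s) -
     (Derive_n y 2 s * Derive_n x 2 s + Derive_n y 1 s * Derive_n x 3 s))
    by (unfold dder; ring).
  apply (is_derive_minus (fun s => Derive_n x 1 s * Derive_n y 2 s)
    (fun s => Derive_n y 1 s * Derive_n x 2 s));
  apply (is_derive_mult (Derive_n _ 1) (Derive_n _ 2)); auto; intros; apply Rmult_comm.
Qed.

Lemma continuity_pt_Derive_n x y n s :
  smooth_closed_curve x y ->
  continuity_pt (Derive_n x n) s /\ continuity_pt (Derive_n y n) s.
Proof.
  intros H. destruct (is_derive_Derive_n x y n s H).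
  split; apply continuity_pt_filterlim, (ex_derive_continuous (Derive_n _ n)); eexists; eauto.
Qed.

Lemma continuity_pt_dder_comp x y i j (g h : R -> R) z :
  smooth_closed_curve x y -> continuity_pt g z -> continuity_pt h z ->
  continuity_pt (fun z => dder x y i (g z) j (h z)) z.
Proof.
  intros H Hg Hh. unfold dder.
  apply continuity_pt_minus; apply continuity_pt_mult;
    (apply (continuity_pt_comp g (Derive_n _ _)) || apply (continuity_pt_comp h (Derive_n _ _)));
    auto; now apply (continuity_pt_Derive_n x y).
Qed.

Lemma continuity_2d_pt_dder x y i j s t :
  smooth_closed_curve x y -> continuity_2d_pt (fun s t => dder x y i s j t) s t.
Proof.
  intros H. unfold dder.
  apply continuity_2d_pt_minus; apply continuity_2d_pt_mult;
    (apply (continuity_1d_2d_pt_comp (Derive_n _ _) (fun s t => s)) ||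
     apply (continuity_1d_2d_pt_comp (Derive_n _ _) (fun s t => t)));
    try apply continuity_2d_pt_id1; try apply continuity_2d_pt_id2;
    now apply (continuity_pt_Derive_n x y).
Qed.

(** If F_s = 0, then f''(s) is parallel to f'(t), hence to f'(s), and s is an inflexion; likewise
    F_t = 0 makes t one. A critical pair would consist of two inflexions. *)
Lemma parallel_gradient_nonzero x y s t :
  regular x y -> dder x y 1 s 1 t = 0 ->
  ~ inflexion x y s \/ ~ inflexion x y t ->
  dder x y 2 s 1 t <> 0 \/ dder x y 1 s 2 t <> 0.
Proof.
  intros Hreg Hp Hi. assert (Rs := Hreg s). assert (Rt := Hreg t).
  destruct (Req_dec (dder x y 2 s 1 t) 0) as [E1|]; auto.
  destruct (Req_dec (dder x y 1 s 2 t) 0) as [E2|]; auto. exfalso.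
  unfold inflexion, dder in *.
  revert Rs Rt Hp E1 E2 Hi.
  generalize (Derive_n x 1 s) (Derive_n y 1 s) (Derive_n x 1 t) (Derive_n y 1 t)
    (Derive_n x 2 s) (Derive_n y 2 s) (Derive_n x 2 t) (Derive_n y 2 t).
  intros p1 p2 q1 q2 p1' p2' q1' q2' Rs Rt Hp E1 E2.
  assert (Np : p1 * p1 + p2 * p2 <> 0) by (destruct Rs; nra).
  assert (Nq : q1 * q1 + q2 * q2 <> 0) by (destruct Rt; nra).
  intros [Hi|Hi]; apply Hi.
  (* Multiplied by |f'(t)|², the determinant at s is a combination of det(f'(s), f'(t)) and
     det(f''(s), f'(t)), both zero. *)
  - apply Rmult_eq_reg_l with (q1 * q1 + q2 * q2); auto.
    replace ((q1 * q1 + q2 * q2) * (p1 * p2' - p2 * p1')) with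
      ((p1 * q2 - p2 * q1) * (q1 * p1' + q2 * p2') - (p1 * q1 + p2 * q2) * (p1' * q2 - p2' * q1))
      by ring.
    rewrite Hp, E1. ring.
  - apply Rmult_eq_reg_l with (p1 * p1 + p2 * p2); auto.
    replace ((p1 * p1 + p2 * p2) * (q1 * q2' - q2 * q1')) with
      ((p1 * q1 + p2 * q2) * (p1 * q2' - p2 * q1') - (p1 * q2 - p2 * q1) * (p1 * q1' + p2 * q2'))
      by ring.
    rewrite Hp, E2. ring.
Qed.

(** One variable is moved at a time, so the two partial derivatives are taken at different points.
    This is harmless where both are close to a common value. *)
Lemma dder_mean_value x y s t s' t' :
  smooth_closed_curve x y ->
  exists c d, (Rmin s s' <= c <= Rmax s s') /\ (Rmin t t' <= d <= Rmax t t') /\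
    dder x y 1 s' 1 t' - dder x y 1 s 1 t =
    dder x y 2 c 1 t' * (s' - s) + dder x y 1 s 2 d * (t' - t).
Proof.
  intros H.
  assert (C : forall f (df : R -> R) z, (forall z, is_derive f z (df z)) -> continuity_pt f z).
  { intros f df z Hf. apply continuity_pt_filterlim, (ex_derive_continuous f). now exists (df z). }
  destruct (MVT_gen (fun s => dder x y 1 s 1 t') s s' (fun s => dder x y 2 s 1 t')) as [c [Hc Ec]].
  - intros z _. now apply is_derive_dder_l.
  - intros z _. apply (C _ (fun s => dder x y 2 s 1 t')). intros; now apply is_derive_dder_l.
  - destruct (MVT_gen (fun t => dder x y 1 s 1 t) t t' (fun t => dder x y 1 s 2 t)) as [d [Hd Ed]].
    + intros z _. now apply is_derive_dder_r.
    + intros z _. apply (C _ (fun t => dder x y 1 s 2 t)). intros; now apply is_derive_dder_r.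
    + exists c, d. split; auto. split; auto. simpl in Ec, Ed. lra.
Qed.

Lemma continuity_pt_ball (g : R -> R) z e :
  continuity_pt g z -> 0 < e ->
  exists d, 0 < d /\ forall u, z - d < u < z + d -> Rabs (g u - g z) < e.
Proof.
  intros Hg He. destruct (Hg e He) as [d [Hd H]]. exists d. split; auto.
  intros u Hu. destruct (Req_dec u z) as [->|Hne].
  - now rewrite Rminus_diag, Rabs_R0.
  - apply (H u). split; [split; [exact I|auto]|]. simpl. apply Rabs_def1; lra.
Qed.

Lemma Rabs_between c s s' s0 e :
  Rmin s s' <= c <= Rmax s s' -> Rabs (s - s0) < e -> Rabs (s' - s0) < e -> Rabs (c - s0) < e.
Proof.
  intros H H1 H2. apply Rabs_def2 in H1. apply Rabs_def2 in H2. revert H.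
  unfold Rmin, Rmax; destruct (Rle_dec s s'); intros; apply Rabs_def1; lra.
Qed.

(** A chord orthogonal to the tangent of the level set would, by the mean value
    theorem, also be orthogonal to a nearby gradient, hence trivial. *)
Lemma chord_same_sign_near x y a b p q z :
  smooth_closed_curve x y ->
  (forall u, p < u < q -> continuity_pt a u /\ continuity_pt b u /\ dder x y 1 (a u) 1 (b u) = 0) ->
  (forall u v, p < u < q -> p < v < q -> a u = a v -> b u = b v -> u = v) ->
  p < z < q ->
  dder x y 2 (a z) 1 (b z) <> 0 \/ dder x y 1 (a z) 2 (b z) <> 0 ->
  exists e, 0 < e /\
    forall w u v w' u' v', z - e < w < z + e -> z - e < u < z + e -> z - e < v < z + e ->
      z - e < w' < z + e -> z - e < u' < z + e -> z - e < v' < z + e -> u < v -> u' < v' ->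
      0 < chord x y a b w u v * chord x y a b w' u' v'.
Proof.
  intros Hs Hab Hinj Hz Hgrad.
  set (s0 := dder x y 2 (a z) 1 (b z)) in *. set (t0 := dder x y 1 (a z) 2 (b z)) in *.
  (* Let k be this bound. Partial derivatives s, s' within k of s0 and t, t' within k of t0 satisfy
     s s' + t t' >= s0² + t0² - 18k², while s0² + t0² >= 32k²; so the sum is positive. *)
  assert (Hk : 0 < (Rabs s0 + Rabs t0) / 8).
  { assert (A1 := Rabs_pos s0). assert (A2 := Rabs_pos t0).
    destruct Hgrad as [G|G]; apply Rabs_pos_lt in G; lra. }
  set (k := (Rabs s0 + Rabs t0) / 8) in *.
  destruct (continuity_2d_pt_dder x y 2 1 (a z) (b z) Hs (mkposreal _ Hk)) as [[d1 Hd1] K1].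
  destruct (continuity_2d_pt_dder x y 1 2 (a z) (b z) Hs (mkposreal _ Hk)) as [[d2 Hd2] K2].
  simpl in K1, K2. fold s0 in K1. fold t0 in K2.
  assert (Hd : 0 < Rmin d1 d2) by now apply Rmin_pos.
  assert (L1 := Rmin_l d1 d2). assert (L2 := Rmin_r d1 d2).
  set (d := Rmin d1 d2) in *.
  destruct (Hab z Hz) as [Ca [Cb _]].
  destruct (continuity_pt_ball a z d Ca Hd) as [e1 [He1 B1]].
  destruct (continuity_pt_ball b z d Cb Hd) as [e2 [He2 B2]].
  exists (Rmin (Rmin e1 e2) (Rmin (z - p) (q - z))).
  assert (He : 0 < Rmin (Rmin e1 e2) (Rmin (z - p) (q - z))).
  { repeat apply Rmin_pos; lra. }
  assert (L3 := Rmin_l (Rmin e1 e2) (Rmin (z - p) (q - z))).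
  assert (L4 := Rmin_r (Rmin e1 e2) (Rmin (z - p) (q - z))).
  set (e := Rmin (Rmin e1 e2) (Rmin (z - p) (q - z))) in *.
  assert (L5 := Rmin_l e1 e2). assert (L6 := Rmin_r e1 e2).
  assert (L7 := Rmin_l (z - p) (q - z)). assert (L8 := Rmin_r (z - p) (q - z)).
  split; [auto|].
  intros w u v w' u' v' Hw Hu Hv Hw' Hu' Hv' Huv Huv'.
  apply (same_sign_on_chords (chord x y a b) (z - e) (z + e)); auto; clear - Hs Hab Hinj Hk K1 K2 B1 B2 L1 L2 L3 L4 L5 L6 L7 L8 k.
  - intros w u v w' u' v' r Hw Hu Hv Hw' Hu' Hv' Hr. unfold chord.
    assert (Sa : forall m n, z - e < m < z + e -> z - e < n < z + e ->
      continuity_pt (fun r => a (m + r * (n - m))) r).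
    { intros m n Hm Hn. apply continuity_pt_segment with (z - e) (z + e); auto.
      intros i Hi. apply Hab; lra. }
    assert (Sb : forall m n, z - e < m < z + e -> z - e < n < z + e ->
      continuity_pt (fun r => b (m + r * (n - m))) r).
    { intros m n Hm Hn. apply continuity_pt_segment with (z - e) (z + e); auto.
      intros i Hi. apply Hab; lra. }
    apply continuity_pt_minus; (apply continuity_pt_mult;
      [ apply continuity_pt_minus; auto
      | apply (continuity_pt_dder_comp x y _ _ (fun r => a (w + r * (w' - w)))
               (fun r => b (w + r * (w' - w)))); auto ]).
  - intros w u v Hw Hu Hv Huv E. unfold chord in E.
    destruct (dder_mean_value x y (a u) (b u) (a v) (b v) Hs) as [c [c' [Hc [Hc' M]]]].
    destruct (Hab u ltac:(lra)) as [_ [_ Pu]]. destruct (Hab v ltac:(lra)) as [_ [_ Pv]].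
    rewrite Pu, Pv, Rminus_diag in M.
    assert (Rc : Rabs (c - a z) < d) by (apply Rabs_between with (a u) (a v); auto; apply B1; lra).
    assert (Rc' : Rabs (c' - b z) < d) by (apply Rabs_between with (b u) (b v); auto; apply B2; lra).
    assert (Ra : forall i, z - e < i < z + e -> Rabs (a i - a z) < d) by (intros; apply B1; lra).
    assert (Rb : forall i, z - e < i < z + e -> Rabs (b i - b z) < d) by (intros; apply B2; lra).
    assert (V1 : Rabs (dder x y 2 (a w) 1 (b w) - s0) < k)
      by (apply K1; (eapply Rlt_le_trans; [eauto|lra])).
    assert (V2 : Rabs (dder x y 2 c 1 (b v) - s0) < k)
      by (apply K1; (eapply Rlt_le_trans; [eauto|lra])).
    assert (V3 : Rabs (dder x y 1 (a w) 2 (b w) - t0) < k)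
      by (apply K2; (eapply Rlt_le_trans; [eauto|lra])).
    assert (V4 : Rabs (dder x y 1 (a u) 2 c' - t0) < k)
      by (apply K2; (eapply Rlt_le_trans; [eauto|lra])).
    assert (N : a v - a u = 0 /\ b v - b u = 0); [|assert (u = v) by (apply Hinj; lra); lra].
    revert E M V1 V2 V3 V4 Hk. unfold k. clear.
    generalize (dder x y 2 (a w) 1 (b w)) (dder x y 2 c 1 (b v)) (dder x y 1 (a w) 2 (b w))
      (dder x y 1 (a u) 2 c') (a v - a u) (b v - b u).
    intros s s' t t' A B E M V1 V2 V3 V4 Hk.
    (* [E] and [M] are a homogeneous linear system in the increments [A], [B] with determinant s s'
       + t t'. *)
    assert (P : 0 < s * s' + t * t').
    { assert (F : forall r r0 r', Rabs (r - r0) < (Rabs s0 + Rabs t0) / 8 ->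
        Rabs (r' - r0) < (Rabs s0 + Rabs t0) / 8 ->
        Rabs r0 * Rabs r0 - 2 * Rabs r0 * ((Rabs s0 + Rabs t0) / 8)
          - ((Rabs s0 + Rabs t0) / 8) * ((Rabs s0 + Rabs t0) / 8) <= r * r').
      { intros r r0 r'. generalize ((Rabs s0 + Rabs t0) / 8). intros k H1 H2.
        apply Rabs_def2 in H1. apply Rabs_def2 in H2.
        unfold Rabs; destruct (Rcase_abs r0); nra. }
      assert (F1 := F s s0 s' V1 V2). assert (F2 := F t t0 t' V3 V4). clear F V1 V2 V3 V4.
      revert F1 F2 Hk. generalize (Rabs s0) (Rabs t0). clear. intros S T F1 F2 Hk.
      assert (0 <= (S - T) * (S - T)) by apply Rle_0_sqr.
      assert (0 < (S + T) / 8 * ((S + T) / 8)) by now apply Rmult_lt_0_compat.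
      lra. }
    split.
    + assert (Z : A * (s * s' + t * t') = 0); [|apply Rmult_integral in Z; lra].
      replace (A * (s * s' + t * t')) with (s * (s' * A + t' * B) + t' * (A * t - B * s)) by ring.
      rewrite E, <- M. ring.
    + assert (Z : B * (s * s' + t * t') = 0); [|apply Rmult_integral in Z; lra].
      replace (B * (s * s' + t * t')) with (t * (s' * A + t' * B) - s' * (A * t - B * s)) by ring.
      rewrite E, <- M. ring.
Qed.

(** The sign of [chord] does not depend on which point of the pair is ahead of
    the inflexion, so no order between [a] and [b] has to be tracked. *)
Lemma chord_swap_ends x y a b w u v : chord x y b a w u v = chord x y a b w u v.
Proof. unfold chord, dder. ring. Qed.

Lemma dder_mirror x y i s j t : dder y x i s j t = - dder x y i s j t.
Proof. unfold dder. ring. Qed.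

(** Exchanging the coordinates reflects the curve in the diagonal. This reduces inflexions with
    det(f', f''') < 0 to those with det(f', f''') > 0. *)
Lemma chord_mirror x y a b w u v : chord y x a b w u v = - chord x y a b w u v.
Proof. unfold chord, dder. ring. Qed.

(** Running the path backwards turns its end into a start; the minus sign is the source of the
    opposite signs at the two inflexions. *)
Lemma chord_reverse x y a b w u v :
  chord x y (fun u => a (1 - u)) (fun u => b (1 - u)) w u v =
  - chord x y a b (1 - w) (1 - v) (1 - u).
Proof. unfold chord. ring. Qed.

(** * Parallel pairs close to an inflexion point *)

Definition tdot (x y : R -> R) (s t : R) : R :=
  Derive_n x 1 s * Derive_n x 1 t + Derive_n y 1 s * Derive_n y 1 t.

Lemma sign_near_simple_zero (f : R -> R) z d :
  is_derive f z d -> f z = 0 -> 0 < d ->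
  exists e, 0 < e /\ (forall s, z < s < z + e -> 0 < f s) /\ (forall s, z - e < s < z -> f s < 0).
Proof.
  intros Hf Z Hd. apply is_derive_Reals in Hf.
  destruct (Hf d Hd) as [[e He] H]. simpl in H.
  assert (K : forall s, s <> z -> Rabs (s - z) < e -> 0 < f s / (s - z)).
  { intros s Hs Hs'. specialize (H (s - z) ltac:(lra) Hs').
    rewrite Rplus_minus, Z, Rminus_0_r in H. apply Rabs_def2 in H. lra. }
  exists e. split; auto. split; intros s Hs.
  - specialize (K s ltac:(lra) ltac:(apply Rabs_def1; lra)).
    replace (f s) with (f s / (s - z) * (s - z)) by (field; lra). nra.
  - specialize (K s ltac:(lra) ltac:(apply Rabs_def1; lra)).
    replace (f s) with (f s / (s - z) * (s - z)) by (field; lra). nra.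
Qed.

Lemma continuity_pt_tdot x y s t :
  smooth_closed_curve x y -> continuity_pt (tdot x y s) t.
Proof.
  intros H. unfold tdot. destruct (continuity_pt_Derive_n x y 1 t H).
  apply continuity_pt_plus; apply continuity_pt_mult; auto;
    apply continuity_pt_const; now intros ? ?.
Qed.

Lemma tdot_self_pos x y s : regular x y -> 0 < tdot x y s s.
Proof. intros H. unfold tdot. destruct (H s); nra. Qed.

Lemma tdot_pos_near x y t :
  smooth_closed_curve x y -> regular x y ->
  exists e, 0 < e /\ forall s, t - e < s < t + e -> 0 < tdot x y t s.
Proof.
  intros Hs Hr. assert (P := tdot_self_pos x y t Hr).
  destruct (continuity_pt_ball (tdot x y t) t _ (continuity_pt_tdot x y t t Hs) P) as [e [He H]].
  exists e. split; auto. intros s Hse. specialize (H s Hse). apply Rabs_def2 in H. lra.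
Qed.

(** With the tangent at [t] as reference axis, [slope x y t s] is the tangent of
    the angle from [f'(t)] to [f'(s)]. *)
Definition slope (x y : R -> R) (t s : R) : R := dder x y 1 t 1 s / tdot x y t s.

(** The numerator of the quotient rule collapses to |f'(t)|² det(f'(s), f''(s)), so the slope rises
    or falls with the sign of the curvature. *)
Lemma is_derive_slope x y t s :
  smooth_closed_curve x y -> 0 < tdot x y t s ->
  is_derive (slope x y t) s (tdot x y t t * dder x y 1 s 2 s / tdot x y t s ^ 2).
Proof.
  intros H P. destruct (is_derive_Derive_n x y 1 s H).
  assert (Dt : is_derive (tdot x y t) s
    (Derive_n x 1 t * Derive_n x 2 s + Derive_n y 1 t * Derive_n y 2 s)).
  { unfold tdot. apply (is_derive_plus (fun s => Derive_n x 1 t * Derive_n x 1 s)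
      (fun s => Derive_n y 1 t * Derive_n y 1 s)); now apply is_derive_scal. }
  assert (Q := is_derive_div _ _ s _ _ (is_derive_dder_r x y 1 t 1 s H) Dt ltac:(lra)).
  unfold slope. evar_last; [exact Q|].
  f_equal. unfold tdot, dder. ring.
Qed.

Lemma slope_increment x y t s s' :
  smooth_closed_curve x y -> regular x y -> s < s' ->
  (forall r, s <= r <= s' -> 0 < tdot x y t r) ->
  exists r, s < r < s' /\ exists k, 0 < k /\
    slope x y t s' - slope x y t s = k * dder x y 1 r 2 r.
Proof.
  intros H Hr Hs P.
  destruct (MVT_cor2 (slope x y t)
    (fun s => tdot x y t t * dder x y 1 s 2 s / tdot x y t s ^ 2) s s' Hs) as [r [E Hrr]].
  { intros r Hrr. apply is_derive_Reals, is_derive_slope; auto. }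
  exists r. split; auto.
  assert (P1 := P r ltac:(lra)). assert (P2 := tdot_self_pos x y t Hr).
  exists (tdot x y t t / tdot x y t r ^ 2 * (s' - s)). split.
  - apply Rmult_lt_0_compat; [|lra]. apply Rdiv_lt_0_compat; auto. now apply pow_lt.
  - rewrite E. field. lra.
Qed.

(** Cross-multiplied, the difference of the two slopes is -|f'(t)|² det(f'(s), f'(s')). *)
Lemma parallel_slope_eq x y t s s' :
  regular x y -> 0 < tdot x y t s -> 0 < tdot x y t s' ->
  dder x y 1 s 1 s' = 0 -> slope x y t s = slope x y t s'.
Proof.
  intros Hr P P' E. unfold slope.
  assert (K : dder x y 1 t 1 s * tdot x y t s' = dder x y 1 t 1 s' * tdot x y t s).
  { apply Rminus_diag_uniq.
    replace (dder x y 1 t 1 s * tdot x y t s' - dder x y 1 t 1 s' * tdot x y t s)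
      with (- tdot x y t t * dder x y 1 s 1 s') by (unfold tdot, dder; ring).
    rewrite E. ring. }
  apply Rmult_eq_reg_r with (tdot x y t s * tdot x y t s'); [|nra].
  replace (dder x y 1 t 1 s / tdot x y t s * (tdot x y t s * tdot x y t s'))
    with (dder x y 1 t 1 s * tdot x y t s') by (field; lra).
  rewrite K. field. lra.
Qed.

(** Parallel vectors in the same open half-plane, here the one around f'(t), point in the same
    direction. *)
Lemma parallel_tdot_pos x y t s s' :
  regular x y -> 0 < tdot x y t s -> 0 < tdot x y t s' ->
  dder x y 1 s 1 s' = 0 -> 0 < tdot x y s s'.
Proof.
  intros Hr P P' E. assert (Ps := tdot_self_pos x y s' Hr).
  assert (K : tdot x y s' s' * tdot x y t s = tdot x y s s' * tdot x y t s').
  { apply Rminus_diag_uniq.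
    replace (tdot x y s' s' * tdot x y t s - tdot x y s s' * tdot x y t s')
      with (dder x y 1 t 1 s' * dder x y 1 s 1 s') by (unfold tdot, dder; ring).
    rewrite E. ring. }
  assert (0 < tdot x y s' s' * tdot x y t s) by nra. nra.
Qed.

(** Here f'(s) = k f'(s') with k > 0. The partial derivatives of F at a pair thus take their signs
    from the curvature at the single points. *)
Lemma parallel_dder_sign x y s s' :
  regular x y -> 0 < tdot x y s s' -> dder x y 1 s 1 s' = 0 ->
  exists k, 0 < k /\ dder x y 1 s 2 s' = k * dder x y 1 s' 2 s'.
Proof.
  intros Hr P E. assert (Ps := tdot_self_pos x y s' Hr).
  exists (tdot x y s s' / tdot x y s' s'). split; [now apply Rdiv_lt_0_compat|].
  apply Rmult_eq_reg_l with (tdot x y s' s'); [|lra].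
  replace (tdot x y s' s' * (tdot x y s s' / tdot x y s' s' * dder x y 1 s' 2 s'))
    with (tdot x y s s' * dder x y 1 s' 2 s') by (field; lra).
  apply Rminus_diag_uniq.
  replace (tdot x y s' s' * dder x y 1 s 2 s' - tdot x y s s' * dder x y 1 s' 2 s')
    with (dder x y 1 s 1 s' * (Derive_n x 1 s' * Derive_n x 2 s' + Derive_n y 1 s' * Derive_n y 2 s'))
    by (unfold tdot, dder; ring).
  rewrite E. ring.
Qed.

(** The slope decreases on the left of t and increases on the right, and it agrees at [a u] and
    [b u]. So as [a] moves away from t to the right, [b] moves away to the left. With the curvature
    signs on the two sides, both terms of [chord] are negative. *)
Lemma chord_neg_straddling x y a b t e d :
  smooth_closed_curve x y -> regular x y ->
  0 < d ->
  (forall s, t - e < s < t + e -> 0 < tdot x y t s) ->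
  (forall s, t < s < t + e -> 0 < dder x y 1 s 2 s) ->
  (forall s, t - e < s < t -> dder x y 1 s 2 s < 0) ->
  (forall u, 0 < u < d -> continuity_pt a u /\ dder x y 1 (a u) 1 (b u) = 0) ->
  (forall u v, 0 < u < d -> 0 < v < d -> a u = a v -> b u = b v -> u = v) ->
  (forall u, 0 < u < d -> t - e < b u < t /\ t < a u < t + e) ->
  (forall k, 0 < k -> exists d', 0 < d' /\ forall u, 0 < u < d' -> Rabs (a u - t) < k) ->
  forall w u v, 0 < w < d -> 0 < u < d -> 0 < v < d -> u < v -> chord x y a b w u v < 0.
Proof.
  intros Hs Hr Hd Ht Dp Dn Hp Hinj Hst Hlim.
  assert (Sa : forall s s', t <= s -> s < s' -> s' < t + e -> slope x y t s < slope x y t s').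
  { intros s s' H1 H2 H3.
    destruct (slope_increment x y t s s') as [r [Hrr [k [Hk E]]]]; auto.
    { intros; apply Ht; lra. }
    specialize (Dp r ltac:(lra)). nra. }
  assert (Sb : forall s s', t - e < s -> s < s' -> s' <= t -> slope x y t s' < slope x y t s).
  { intros s s' H1 H2 H3.
    destruct (slope_increment x y t s s') as [r [Hrr [k [Hk E]]]]; auto.
    { intros; apply Ht; lra. }
    specialize (Dn r ltac:(lra)). nra. }
  assert (Eq : forall u, 0 < u < d -> slope x y t (a u) = slope x y t (b u)).
  { intros u Hu. destruct (Hst u Hu). apply parallel_slope_eq; auto; try (apply Ht; lra).
    now apply Hp. }
  assert (Inj : forall u v, 0 < u < d -> 0 < v < d -> a u = a v -> u = v).
  { intros u v Hu Hv E. apply Hinj; auto. assert (Eu := Eq u Hu). assert (Ev := Eq v Hv).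
    rewrite E in Eu. destruct (Hst u Hu), (Hst v Hv).
    destruct (Rtotal_order (b u) (b v)) as [L|[L|L]]; auto;
      apply Sb in L; lra. }
  assert (Inc : forall u v, 0 < u < d -> 0 < v < d -> u < v -> a u < a v).
  { intros u v Hu Hv Huv.
    destruct (Hst (d / 2) ltac:(lra)) as [_ Hm].
    (* Injectivity makes [a] monotone; a time m < d / 2 at which [a] is closer to t than at d / 2
       shows that it increases. *)
    destruct (Hlim (a (d / 2) - t) ltac:(lra)) as [d' [Hd' L]].
    assert (Hmin := Rmin_pos d' (d / 2) Hd' ltac:(lra)).
    assert (M1 := Rmin_l d' (d / 2)). assert (M2 := Rmin_r d' (d / 2)).
    set (m := Rmin d' (d / 2) / 2).
    assert (Hm2 : 0 < m < d / 2 /\ m < d') by (unfold m; lra).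
    specialize (L m ltac:(lra)). apply Rabs_def2 in L.
    assert (S := injective_same_sign a 0 d (fun z Hz => proj1 (Hp z Hz)) Inj
      u v m (d / 2) Hu Hv ltac:(lra) ltac:(lra) Huv ltac:(lra)). nra. }
  intros w u v Hw Hu Hv Huv.
  assert (A := Inc u v Hu Hv Huv).
  destruct (Hst u Hu) as [Bu Au]. destruct (Hst v Hv) as [Bv Av]. destruct (Hst w Hw) as [Bw Aw].
  assert (B : b v < b u).
  { assert (Eu := Eq u Hu). assert (Ev := Eq v Hv).
    assert (L := Sa (a u) (a v) ltac:(lra) A ltac:(lra)).
    destruct (Rtotal_order (b u) (b v)) as [L'|[L'|L']]; auto.
    - apply Sb in L'; lra.
    - rewrite L' in Eu. lra. }
  assert (Pw := proj2 (Hp w Hw)).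
  assert (Tw : 0 < tdot x y (a w) (b w)).
  { apply parallel_tdot_pos with t; auto; apply Ht; lra. }
  destruct (parallel_dder_sign x y (a w) (b w)) as [k [Hk E1]]; auto.
  destruct (parallel_dder_sign x y (b w) (a w)) as [k' [Hk' E2]]; auto.
  { replace (tdot x y (b w) (a w)) with (tdot x y (a w) (b w)) by (unfold tdot; ring). auto. }
  { rewrite dder_antisym, Pw. ring. }
  unfold chord. rewrite (dder_antisym x y 2 1), E1, E2.
  specialize (Dp (a w) Aw). specialize (Dn (b w) Bw).
  assert (0 < k * - dder x y 1 (b w) 2 (b w)) by (apply Rmult_lt_0_compat; lra).
  assert (0 < k' * dder x y 1 (a w) 2 (a w)) by (apply Rmult_lt_0_compat; lra).
  nra.
Qed.

(** Two points on the same side of t would have different slopes, because the curvature keeps its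
    sign between them. *)
Lemma parallel_straddle x y t e s s' :
  smooth_closed_curve x y -> regular x y ->
  (forall s, t - e < s < t + e -> 0 < tdot x y t s) ->
  (forall s, t < s < t + e -> 0 < dder x y 1 s 2 s) ->
  (forall s, t - e < s < t -> dder x y 1 s 2 s < 0) ->
  t - e < s < t + e -> t - e < s' < t + e -> s < s' -> dder x y 1 s 1 s' = 0 ->
  s < t < s'.
Proof.
  intros Hs Hr Ht Dp Dn B B' Hlt E.
  assert (Eq : slope x y t s = slope x y t s') by (apply parallel_slope_eq; auto).
  split; apply Rnot_le_lt; intros N;
    (destruct (slope_increment x y t s s') as [r [Hrr [k [Hk I]]]]; auto;
      [intros; apply Ht; lra|]).
  - specialize (Dp r ltac:(lra)). nra.
  - specialize (Dn r ltac:(lra)). nra.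
Qed.

(** Near t each pair straddles t, so [a] never meets t and stays on one side by continuity. The side
    is read off at d / 2; the second case is the first with [a] and [b] exchanged. *)
Lemma chord_neg_at_inflexion x y a b t :
  smooth_closed_curve x y -> regular x y ->
  inflexion x y t -> 0 < dder x y 1 t 3 t ->
  (forall u, 0 < u < 1 ->
     continuity_pt a u /\ continuity_pt b u /\ a u <> b u /\ dder x y 1 (a u) 1 (b u) = 0) ->
  (forall u v, 0 < u < 1 -> 0 < v < 1 -> a u = a v -> b u = b v -> u = v) ->
  (forall k, 0 < k -> exists d, 0 < d <= 1 /\ forall u, 0 < u < d -> Rabs (a u - t) < k) ->
  (forall k, 0 < k -> exists d, 0 < d <= 1 /\ forall u, 0 < u < d -> Rabs (b u - t) < k) ->
  exists d, 0 < d <= 1 /\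
    forall w u v, 0 < w < d -> 0 < u < d -> 0 < v < d -> u < v -> chord x y a b w u v < 0.
Proof.
  intros Hs Hr Ht Hd Hp Hinj La Lb.
  destruct (tdot_pos_near x y t Hs Hr) as [e1 [He1 T1]].
  destruct (sign_near_simple_zero _ t _ (is_derive_inflexion_det x y t Hs) Ht Hd)
    as [e2 [He2 [T2 T3]]].
  assert (He := Rmin_pos e1 e2 He1 He2).
  assert (M1 := Rmin_l e1 e2). assert (M2 := Rmin_r e1 e2).
  set (e := Rmin e1 e2) in *.
  destruct (La e He) as [d1 [Hd1 B1]]. destruct (Lb e He) as [d2 [Hd2 B2]].
  assert (Hdm : 0 < Rmin d1 d2) by (apply Rmin_pos; lra).
  assert (M3 := Rmin_l d1 d2). assert (M4 := Rmin_r d1 d2).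
  set (d := Rmin d1 d2) in *.
  assert (T : forall s, t - e < s < t + e -> 0 < tdot x y t s) by (intros; apply T1; lra).
  assert (Dp : forall s, t < s < t + e -> 0 < dder x y 1 s 2 s) by (intros; apply T2; lra).
  assert (Dn : forall s, t - e < s < t -> dder x y 1 s 2 s < 0) by (intros; apply T3; lra).
  assert (Ba : forall u, 0 < u < d -> t - e < a u < t + e).
  { intros u Hu. specialize (B1 u ltac:(lra)). apply Rabs_def2 in B1. lra. }
  assert (Bb : forall u, 0 < u < d -> t - e < b u < t + e).
  { intros u Hu. specialize (B2 u ltac:(lra)). apply Rabs_def2 in B2. lra. }
  assert (St : forall u, 0 < u < d -> (b u < t < a u) \/ (a u < t < b u)).
  { intros u Hu. destruct (Hp u ltac:(lra)) as [_ [_ [Hne E]]].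
    destruct (Rtotal_order (a u) (b u)) as [L|[L|L]]; [right|lra|left];
      apply parallel_straddle with x y e; auto.
    rewrite dder_antisym, E. ring. }
  assert (Sg : forall u, 0 < u < d -> 0 < (a (d / 2) - t) * (a u - t)).
  { assert (K : forall u v, 0 < u < d -> 0 < v < d -> u <= v -> 0 < (a u - t) * (a v - t)).
    { intros u v Hu Hv Huv. apply (same_sign_of_nonvanishing (fun u => a u - t)); auto.
      - intros z Hz. apply continuity_pt_minus; [apply Hp; lra|].
        apply continuity_pt_const; now intros ? ?.
      - intros z Hz. destruct (St z ltac:(lra)); lra. }
    intros u Hu. destruct (Rle_lt_dec (d / 2) u) as [C|C].
    - apply K; lra.
    - rewrite Rmult_comm. apply K; lra. }
  exists d. split; [lra|].
  destruct (St (d / 2) ltac:(lra)) as [S0|S0].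
  - apply chord_neg_straddling with t e; auto.
    + intros u Hu. split; apply Hp; lra.
    + intros u v Hu Hv. apply Hinj; lra.
    + intros u Hu. specialize (Sg u Hu). specialize (Ba u Hu). specialize (Bb u Hu).
      destruct (St u Hu); [lra|nra].
    + intros k Hk. destruct (La k Hk) as [d' [Hd' L]]. exists d'. split; [lra|auto].
  - intros w u v Hw Hu Hv Huv. rewrite <- chord_swap_ends. revert w u v Hw Hu Hv Huv.
    apply chord_neg_straddling with t e; auto.
    + intros u Hu. destruct (Hp u ltac:(lra)) as [_ [Cb [_ E]]].
      split; auto. rewrite dder_antisym, E. ring.
    + intros u v Hu Hv E1 E2. apply Hinj; auto; lra.
    + intros u Hu. specialize (Sg u Hu). specialize (Ba u Hu). specialize (Bb u Hu).
      destruct (St u Hu); [nra|lra].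
    + intros k Hk. destruct (Lb k Hk) as [d' [Hd' L]]. exists d'. split; [lra|auto].
Qed.

(** The two ends of the pair may converge to different lifts of t. Subtracting the integers [m] and
    [n] brings both to t and leaves [chord] unchanged; a reflection then makes det(f', f''')
    positive if necessary. *)
Lemma chord_sign_at_start x y a b t :
  smooth_closed_curve x y -> regular x y ->
  inflexion x y t -> dder x y 1 t 3 t <> 0 ->
  (forall u, 0 < u < 1 -> continuity_pt a u /\ continuity_pt b u /\ parallel_pair x y (a u) (b u)) ->
  (forall u v, 0 < u < 1 -> 0 < v < 1 -> a u = a v -> b u = b v -> u = v) ->
  circ_lim a (at_right 0) t -> circ_lim b (at_right 0) t ->
  exists d, 0 < d <= 1 /\
    forall w u v, 0 < w < d -> 0 < u < d -> 0 < v < d -> u < v ->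
      dder x y 1 t 3 t * chord x y a b w u v < 0.
Proof.
  intros Hs Hr Ht Hd Hp Hinj La Lb.
  destruct (circ_lim_lift a t) as [m Hm]; [intros u Hu; now apply Hp|auto|].
  destruct (circ_lim_lift b t) as [n Hn]; [intros u Hu; now apply Hp|auto|].
  set (a' := fun u => a u - IZR m). set (b' := fun u => b u - IZR n).
  assert (Ec : forall w u v, chord x y a' b' w u v = chord x y a b w u v).
  { intros w u v. unfold chord, a', b'. rewrite !dder_shift; auto. ring. }
  assert (Hp' : forall u, 0 < u < 1 ->
     continuity_pt a' u /\ continuity_pt b' u /\ a' u <> b' u /\ dder x y 1 (a' u) 1 (b' u) = 0).
  { intros u Hu. destruct (Hp u Hu) as [Ca [Cb [Hne E]]]. unfold a', b'.
    split; [|split; [|split]].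
    - apply continuity_pt_minus; auto. apply continuity_pt_const; now intros ? ?.
    - apply continuity_pt_minus; auto. apply continuity_pt_const; now intros ? ?.
    - intros Q. apply Hne. now apply same_pt_of_shift with m n.
    - now rewrite dder_shift. }
  assert (Hinj' : forall u v, 0 < u < 1 -> 0 < v < 1 -> a' u = a' v -> b' u = b' v -> u = v).
  { unfold a', b'. intros u v Hu Hv E1 E2. apply Hinj; auto; lra. }
  destruct (Rtotal_order (dder x y 1 t 3 t) 0) as [L|[L|L]]; [|lra|].
  - destruct (chord_neg_at_inflexion y x a' b' t) as [d [Hd' K]]; auto.
    + destruct Hs as [H1 H2]. split; intros; split; try apply H1; apply H2.
    + intros s. destruct (Hr s); auto.
    + unfold inflexion in *. rewrite (dder_mirror x y), Ht. ring.
    + rewrite (dder_mirror x y). lra.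
    + intros u Hu. destruct (Hp' u Hu) as [A1 [A2 [A3 A4]]]. repeat split; auto.
      rewrite (dder_mirror x y), A4. ring.
    + exists d. split; auto. intros w u v Hw Hu Hv Huv.
      specialize (K w u v Hw Hu Hv Huv). rewrite chord_mirror, Ec in K. nra.
  - destruct (chord_neg_at_inflexion x y a' b' t) as [d [Hd' K]]; auto.
    exists d. split; auto. intros w u v Hw Hu Hv Huv.
    specialize (K w u v Hw Hu Hv Huv). rewrite Ec in K. nra.
Qed.

(** * Comparison of the two ends of the branch *)

(** [r] only supplies a reference sign. Asking it of all chords and base points near z gives a
    property of the single parameter z, which can be transported. *)
Definition chord_sign_at (x y a b : R -> R) (r z : R) : Prop :=
  exists e, 0 < e /\ forall w u v,
    z - e < w < z + e -> z - e < u < z + e -> z - e < v < z + e -> u < v ->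
    0 < r * chord x y a b w u v.

(** Implication between parameters is transitive, so [cousin] applies. On a small interval one chord
    of known sign determines the sign of all the others. *)
Lemma chord_sign_transport x y a b r p q z z' :
  (forall z, p < z < q -> exists e, 0 < e /\
    forall w u v w' u' v', z - e < w < z + e -> z - e < u < z + e -> z - e < v < z + e ->
      z - e < w' < z + e -> z - e < u' < z + e -> z - e < v' < z + e -> u < v -> u' < v' ->
      0 < chord x y a b w u v * chord x y a b w' u' v') ->
  p < z -> z <= z' -> z' < q ->
  chord_sign_at x y a b r z -> chord_sign_at x y a b r z'.
Proof.
  intros Hloc Hz Hzz Hz'.
  apply (cousin (fun z z' => chord_sign_at x y a b r z -> chord_sign_at x y a b r z')); auto.
  intros m Hm. destruct (Hloc m ltac:(lra)) as [e [He K]].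
  exists e. split; auto. intros u v Hu Huv Hv _ _ [d [Hd S]].
  assert (Hd' : 0 < Rmin d (Rmin (u - (m - e)) (m + e - u))) by (repeat apply Rmin_pos; lra).
  assert (M1 := Rmin_l d (Rmin (u - (m - e)) (m + e - u))).
  assert (M2 := Rmin_r d (Rmin (u - (m - e)) (m + e - u))).
  assert (M3 := Rmin_l (u - (m - e)) (m + e - u)).
  assert (M4 := Rmin_r (u - (m - e)) (m + e - u)).
  set (d' := Rmin d (Rmin (u - (m - e)) (m + e - u))) in *.
  specialize (S u u (u + d' / 2) ltac:(lra) ltac:(lra) ltac:(lra) ltac:(lra)).
  exists (Rmin (v - (m - e)) (m + e - v)). split; [apply Rmin_pos; lra|].
  assert (M5 := Rmin_l (v - (m - e)) (m + e - v)).
  assert (M6 := Rmin_r (v - (m - e)) (m + e - v)).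
  intros w' u' v' Hw' Hu' Hv' Huv'.
  specialize (K u u (u + d' / 2) w' u' v' ltac:(lra) ltac:(lra) ltac:(lra)
    ltac:(lra) ltac:(lra) ltac:(lra) ltac:(lra) ltac:(lra)).
  destruct (Rlt_le_dec 0 (r * chord x y a b w' u' v')) as [|C]; auto. exfalso.
  revert S K C. generalize (chord x y a b u u (u + d' / 2)) (chord x y a b w' u' v').
  intros c c' S K C.
  assert (0 < (r * c) * (c * c')) by now apply Rmult_lt_0_compat.
  assert (0 <= - (r * c') * (c * c)) by (apply Rmult_le_pos; [lra|apply Rle_0_sqr]).
  lra.
Qed.

Lemma at_left_1_reverse (f : R -> R) (l : R) :
  filterlim f (at_left 1) (locally l) -> filterlim (fun u => f (1 - u)) (at_right 0) (locally l).
Proof.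
  intros H P HP. destruct (H P HP) as [e He]. exists e. intros u Hu Hpos.
  apply He; [|lra]. change (Rabs (1 - u - 1) < e). change (Rabs (u - 0) < e) in Hu.
  replace (1 - u - 1) with (- (u - 0)) by ring. now rewrite Rabs_Ropp.
Qed.

(** The sign found near 0 is carried to a parameter near 1, where the reversed path gives a second
    sign for the same chord. Comparing both, with the minus sign of the reversal, separates the
    signs of det(f', f''') at t1 and t2. *)
Lemma branch_ends_opposite x y a b t1 t2 :
  smooth_closed_curve x y -> generic_curve x y ->
  css_branch x y a b -> connects x y a b t1 t2 ->
  dder x y 1 t1 3 t1 * dder x y 1 t2 3 t2 < 0.
Proof.
  intros Hs [Hr [_ [Hnd [_ Hgen]]]] [Hp [Hinj _]] [I1 [I2 [La1 [Lb1 [La2 Lb2]]]]].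
  destruct (Hnd t1 I1) as [_ N1]. destruct (Hnd t2 I2) as [_ N2].
  assert (Inj : forall u v, 0 < u < 1 -> 0 < v < 1 -> a u = a v -> b u = b v -> u = v).
  { intros u v Hu Hv E1 E2. apply Hinj; auto. left. rewrite E1, E2. now split. }
  destruct (chord_sign_at_start x y a b t1) as [d1 [Hd1 K1]]; auto.
  destruct (chord_sign_at_start x y (fun u => a (1 - u)) (fun u => b (1 - u)) t2)
    as [d2 [Hd2 K2]]; auto.
  { intros u Hu. destruct (Hp (1 - u) ltac:(lra)) as [Ca [Cb P]]. split; [|split; auto].
    - apply (continuity_pt_comp (fun u => 1 - u) a); auto. apply derivable_continuous_pt. reg.
    - apply (continuity_pt_comp (fun u => 1 - u) b); auto. apply derivable_continuous_pt. reg. }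
  { intros u v Hu Hv E1 E2. assert (1 - u = 1 - v) by (apply Inj; lra). lra. }
  { destruct La2. split; [apply (at_left_1_reverse (fun u => cos (2 * PI * a u)))
                         |apply (at_left_1_reverse (fun u => sin (2 * PI * a u)))]; auto. }
  { destruct Lb2. split; [apply (at_left_1_reverse (fun u => cos (2 * PI * b u)))
                         |apply (at_left_1_reverse (fun u => sin (2 * PI * b u)))]; auto. }
  assert (Loc : forall z, 0 < z < 1 -> exists e, 0 < e /\
    forall w u v w' u' v', z - e < w < z + e -> z - e < u < z + e -> z - e < v < z + e ->
      z - e < w' < z + e -> z - e < u' < z + e -> z - e < v' < z + e -> u < v -> u' < v' ->
      0 < chord x y a b w u v * chord x y a b w' u' v').
  { intros z Hz. destruct (chord_same_sign_near x y a b 0 1 z) as [e [He K]]; auto.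
    - intros u Hu. destruct (Hp u Hu) as [Ca [Cb [_ P]]]. auto.
    - destruct (Hp z Hz) as [_ [_ P]]. apply parallel_gradient_nonzero; auto. apply P.
    - now exists e. }
  assert (Hm := Rmin_pos d1 d2 ltac:(lra) ltac:(lra)).
  assert (M1 := Rmin_l d1 d2). assert (M2 := Rmin_r d1 d2).
  (* Half the minimum puts p strictly inside both end estimates; d1 <= 1 also gives p <= 1 - p, as
     the transport requires. *)
  set (p := Rmin d1 d2 / 2). assert (Hpp : 0 < p < d1 /\ p < d2) by (unfold p; lra).
  assert (Hp2 : p <= 1 / 2) by (unfold p; lra).
  assert (S : chord_sign_at x y a b (- dder x y 1 t1 3 t1) (1 - p)).
  { apply chord_sign_transport with 0 1 p; auto; try lra.
    exists (Rmin p (d1 - p)). split; [apply Rmin_pos; lra|].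
    assert (M3 := Rmin_l p (d1 - p)). assert (M4 := Rmin_r p (d1 - p)).
    intros w u v Hw Hu Hv Huv.
    specialize (K1 w u v ltac:(lra) ltac:(lra) ltac:(lra) Huv). lra. }
  destruct S as [e [He S]].
  assert (He' : 0 < Rmin e p) by (apply Rmin_pos; lra).
  assert (M3 := Rmin_l e p). assert (M4 := Rmin_r e p).
  set (h := Rmin e p / 2). assert (Hh : 0 < h < e /\ h < p) by (unfold h; lra).
  (* The chord from 1 - p to 1 - (p - h) lies in the range of the transported sign and is the
     reversal of the chord from p - h to p. *)
  specialize (S (1 - p) (1 - p) (1 - (p - h)) ltac:(lra) ltac:(lra) ltac:(lra) ltac:(lra)).
  specialize (K2 p (p - h) p ltac:(lra) ltac:(lra) ltac:(lra) ltac:(lra)).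
  rewrite chord_reverse in K2.
  revert S K2. generalize (chord x y a b (1 - p) (1 - p) (1 - (p - h))). intros c S K2.
  apply Rnot_le_lt. intros C.
  assert (0 < - dder x y 1 t1 3 t1 * c * (dder x y 1 t2 3 t2 * c)) by (apply Rmult_lt_0_compat; lra).
  assert (0 <= dder x y 1 t1 3 t1 * dder x y 1 t2 3 t2 * (c * c))
    by (apply Rmult_le_pos; [lra|apply Rle_0_sqr]).
  lra.
Qed.

Theorem theorem4p17 (x y : R -> R) (a b : R -> R) (t1 t2 : R) :
  smooth_closed_curve x y ->
  generic_curve x y ->
  0 <= t1 < 1 -> 0 <= t2 < 1 -> t1 <> t2 ->
  css_branch x y a b ->
  connects x y a b t1 t2 ->
  exists l : list R,
    NoDup l /\
    (forall s, In s l <-> (in_arc t1 t2 s /\ inflexion x y s)) /\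
    Nat.Even (length l).
Proof.
  intros Hs Hgen H1 H2 Hne Hbr Hcon.
  assert (Hper : forall i j s, dder x y i (s + 1) j (s + 1) = dder x y i s j s).
  { intros i j s. rewrite <- (dder_shift x y i j (-1) (-1)) by auto.
    rewrite <- (dder_shift x y i j (-1) (-1) s s) by auto.
    rewrite <- (dder_shift x y i j 1 1 (s + 1 - -1)) by auto. f_equal; ring. }
  apply (even_zeros_in_arc (fun s => dder x y 1 s 2 s) (fun s => dder x y 1 s 3 s)); auto.
  - intros z. now apply is_derive_inflexion_det.
  - intros z Hz. now apply Hgen.
  - apply Hcon.
  - apply Hcon.
  - now apply branch_ends_opposite with a b.
Qed.
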